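(* Let $\alpha\in(0,1)$, let $S_\alpha(t)$, $t\ge 0$, be an $\alpha$-stable subordinator, and let $E_\alpha(t)=\inf\{s\ge 0: S_\alpha(s)>t\}$ be the corresponding inverse stable subordinator. Then for every $t>0$ the distribution of $E_\alpha(t)$ is not infinitely divisible.
   Context: A subordinator is a one-dimensional Lévy process started at $0$ with almost surely non-decreasing sample paths. The $\alpha$-stable subordinator is the subordinator with $\mathbb{E}(e^{-uS_\alpha(t)})=e^{-tu^\alpha}$ for $u>0$, $t\ge 0$. A real random variable $X$ (or its distribution) is infinitely divisible if for each $n>1$ there exist i.i.d. random variables $X_1,\dots,X_n$ (with law depending on $n$) such that $X$ and $X_1+\cdots+X_n$ have the same distribution. *)

(* Defs.v *)
From HB Require Import structures.
From mathcomp Require Import all_boot all_order all_algebra.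
From mathcomp Require Import all_classical all_reals all_analysis.
From mathcomp Require Import measurable_realfun.
Import Order.TTheory GRing.Theory Num.Theory.
Import numFieldNormedType.Exports.

Set Implicit Arguments.
Unset Strict Implicit.
Unset Printing Implicit Defensive.

Local Open Scope classical_set_scope.
Local Open Scope ring_scope.

Section random_variables.
Context d (T : measurableType d) (R : realType) (P : probability T R).

(* Since [B i] may be the whole line, the product rule over the full finite
   family contains the product rule over each of its subfamilies. *)
Definition independent_RVs (I : finType) (X : I -> {RV P >-> R}) : Prop :=
  forall B : I -> set R, (forall i, measurable (B i)) ->
    P [set w | forall i, B i (X i w)] =
    (\prod_(i : I) P (X i @^-1` B i))%E.

(* Equality is only required on Borel sets: the values of a measure on
   non-measurable sets are meaningless. *)
Definition same_distribution (X Y : {RV P >-> R}) : Prop :=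
  forall A : set R, measurable A -> distribution P X A = distribution P Y A.

End random_variables.

(* The i.i.d. variables live on a probability space of their own, as only the
   law [mu] is given. *)
Definition infinitely_divisible (R : realType) (mu : probability R R) : Prop :=
  forall n : nat, (1 < n)%N ->
    exists (d : measure_display) (T : measurableType d) (P : probability T R)
           (X : 'I_n -> {RV P >-> R}),
      [/\ independent_RVs X,
          forall i j, same_distribution (X i) (X j) &
          forall A : set R, measurable A ->
            mu A = distribution P (\sum_(i < n) X i) A].

Section subordinators.
Context d (T : measurableType d) (R : realType) (P : probability T R).

(* Processes with time set [0, +oo[ are represented by families indexed by [R];
   the members with a negative index are never constrained nor used. *)
Implicit Type S : R -> {RV P >-> R}.

Definition independent_increments S : Prop :=
  forall (n : nat) (t : nat -> R), 0 <= t 0%N ->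
    (forall i, (i < n)%N -> t i < t i.+1) ->
    independent_RVs (fun i : 'I_n => S (t i.+1) - S (t i) : {RV P >-> R}).

Definition stationary_increments S : Prop :=
  forall s t : R, 0 <= s -> s < t ->
    same_distribution (S t - S s : {RV P >-> R}) (S (t - s) - S 0).

Definition stochastically_continuous S : Prop :=
  forall s e : R, 0 <= s -> 0 < e ->
    P [set w | e < `|S t w - S s w|] @[t --> within [set t | 0 <= t] (nbhs s)]
      --> (0 : \bar R).

(* Right-continuous paths with left limits are not required: they can always be
   obtained by passing to a modification. *)
Record levy_process S : Prop := LevyProcess {
  levy_start : {ae P, forall w, S 0 w = 0} ;
  levy_independent : independent_increments S ;
  levy_stationary : stationary_increments S ;
  levy_continuous : stochastically_continuous S }.

Definition subordinator S : Prop :=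
  levy_process S /\
  {ae P, forall w, forall s t : R, 0 <= s -> s <= t -> S s w <= S t w}.

Definition stable_subordinator (alpha : R) S : Prop :=
  subordinator S /\
  forall u t : R, 0 < u -> 0 <= t ->
    ('E_P[fun w => expR (- u * S t w)%R] = (expR (- t * u `^ alpha)%R)%:E)%E.

(* Taken in the extended reals, so that the infimum of the empty set is +oo. *)
Definition first_passage_time S (t : R) (w : T) : \bar R :=
  ereal_inf [set s%:E | s in [set s : R | 0 <= s /\ t < S s w]].

(* The paths of [S] are only almost surely monotone and [P] need not be
   complete, so [first_passage_time S t] is finite and measurable only up to a
   null set. [E t] is any random variable almost surely equal to it: one always
   exists for a stable subordinator, and its distribution does not depend on the
   choice. *)
Definition inverse_process S (E : R -> {RV P >-> R}) : Prop :=
  forall t : R, 0 <= t ->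
    {ae P, forall w, (E t w)%:E = first_passage_time S t w}.

End subordinators.

(* Main.v *)
Require Import Defs.
From mathcomp Require Import all_boot all_order all_algebra.
From mathcomp Require Import all_classical all_reals all_analysis.
From mathcomp Require Import measurable_realfun.
From mathcomp Require Import ring lra.
Import Order.TTheory GRing.Theory Num.Theory.
Local Open Scope ring_scope.

(* A light-tail argument. Up to a null set, [E_t > x] forces [S_x <= t], so by
   Markov's inequality applied to [exp (- u S_x)], for every [u > 0],
     P (E_t > x) <= exp (u t - x u ^ alpha);
   with [x = n a] and [u = n] this is [exp (n t - a n ^ (1 + alpha))].
   On the other hand, let [X >= 0] be infinitely divisible and not constant,
   [X = X_1 + ... + X_n], and let [p_n = P (X_1 > a)]. Comparing the Laplace
   transforms of [X] and [X_1] at 1 and at 2, strict Jensen forces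
   [p_n >= c / n] for some [a, c > 0] and all large [n]. Hence
     P (X > n a) >= p_n ^ n >= (c / n) ^ n = exp (- n ln n + n ln c),
   which is incompatible with the first bound. *)

Set Implicit Arguments.
Unset Strict Implicit.
Unset Printing Implicit Defensive.

(** * Product rule for expectations of functions of independent variables *)

Section expectation_product.
Local Open Scope classical_set_scope.
Local Open Scope ereal_scope.
Import HBNNSimple.
Context d (T : measurableType d) (R : realType) (P : probability T R).

Lemma measurable_all_preimage (I : finType) (X : I -> {RV P >-> R})
    (B : I -> set R) : (forall i, measurable (B i)) ->
  measurable [set w | forall i, B i (X i w)].
Proof.
move=> mB.
rewrite (_ : [set _ | _] = \bigcap_(i in [set: I]) (X i @^-1` B i)).
  by apply: fin_bigcap_measurable => // i _; exact: measurable_funPTI.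
by apply/seteqP; split => w /= Bw i; [move=> _; exact: Bw|exact: Bw].
Qed.

Lemma integrable_unit_interval (f : T -> R) :
  measurable_fun setT f -> (forall w, 0 <= f w <= 1)%R ->
  P.-integrable setT (EFin \o f).
Proof.
move=> mf f01; apply: measurable_bounded_integrable => //.
  exact: le_lt_trans (probability_le1 P measurableT) (ltry _).
exists 1%R; split; first exact: num_real.
move=> y y1 w _ /=; have /andP[f0 f1] := f01 w.
by rewrite ger0_norm// (le_trans f1 (ltW y1)).
Qed.

Lemma Rintegral_le1 (f : T -> R) :
  measurable_fun setT f -> (forall w, 0 <= f w <= 1)%R ->
  (\int[P]_w f w <= 1)%R.
Proof.
move=> mf f01; rewrite -[leRHS](_ : (\int[P]_w (1 : R) = 1)%R); last first.
  by rewrite Rintegral_cst// [fine (P setT)](_ : _ = 1%R) ?mul1r// probability_setT.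
apply: le_Rintegral => //; [exact: integrable_unit_interval| |].
  exact: finite_measure_integrable_cst.
by move=> w _; have /andP[] := f01 w.
Qed.

(** Standard extension from indicators: linearity gives the rule for the simple functions [g n], and
    monotone convergence carries it to [f]. Finiteness of the integral of [G] allows it to be
    multiplied into the limit. *)
Lemma integral_mul_comp (G X : T -> R) (f : R -> R) :
  measurable_fun setT G -> (forall w, (0 <= G w)%R) ->
  \int[P]_w (G w)%:E \is a fin_num ->
  measurable_fun setT X ->
  (forall C, measurable C -> \int[P]_w (G w * \1_C (X w))%:E =
                             \int[P]_w (G w)%:E * P (X @^-1` C)) ->
  measurable_fun setT f -> (forall x, (0 <= f x)%R) ->
  \int[P]_w (G w * f (X w))%:E = \int[P]_w (G w)%:E * \int[P]_w (f (X w))%:E.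
Proof.
move=> mG G0 finG mX GX mf f0.
have mf' : measurable_fun setT (EFin \o f) by exact/measurable_EFinP.
pose g := nnsfun_approx measurableT mf'.
have cvg_g x : (g n x)%:E @[n --> \oo] --> (f x)%:E.
  by apply: (@cvg_nnsfun_approx _ _ _ _ measurableT _ mf') => // y _; rewrite lee_fin.
have nd_g x : {homo (fun n => g n x) : n m / (n <= m)%N >-> (n <= m)%R}.
  by move=> n m nm; exact/lefP/nd_nnsfun_approx.
have mgX n : measurable_fun setT (fun w => g n (X w)) by apply: measurableT_comp.
have gE n : \int[P]_w (G w * g n (X w))%:E =
            \int[P]_w (G w)%:E * \int[P]_w (g n (X w))%:E.
  have gXE w : (g n (X w))%:E =
      \sum_(y \in range (g n)) (y%:E * (\1_(g n @^-1` [set y]) (X w))%:E).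
    by rewrite fimfunE -fsumEFin//.
  have mi y : measurable_fun setT
      (fun w => (\1_(g n @^-1` [set y]) (X w) : R)).
    by apply: (measurableT_comp _ mX); exact: measurable_indic.
  (* [y] is an arbitrary real here; a negative one is not a value of [g n], so its indicator
     vanishes. *)
  have y0 y (w : T) : 0 <= y%:E * (\1_(g n @^-1` [set y]) (X w))%:E.
    rewrite -EFinM lee_fin indicE.
    case: (boolP (X w \in _)); rewrite ?mulr0// mulr1.
    by rewrite inE/= => <-.
  under eq_integral.
    move=> w _; rewrite EFinM gXE ge0_mule_fsumr//; over.
  rewrite ge0_integral_fsum//=; last 2 first.
    - move=> y; apply: emeasurable_funM; first exact/measurable_EFinP.
      by apply: emeasurable_funM => //; exact/measurable_EFinP.
    - by move=> y w _; apply: mule_ge0 => //; rewrite lee_fin.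
  have -> : \int[P]_w (g n (X w))%:E = \int[P]_w
      \sum_(y \in range (g n)) (y%:E * (\1_(g n @^-1` [set y]) (X w))%:E).
    by apply: eq_integral => w _; exact: gXE.
  rewrite ge0_integral_fsum//=; last first.
    by move=> y; apply: emeasurable_funM => //; exact/measurable_EFinP.
  rewrite ge0_mule_fsumr; last by move=> y; apply: integral_ge0 => w _.
  apply: eq_fsbigr => y; rewrite inE => -[x _ <-].
  have gx0 : (0 <= g n x)%R by [].
  have mC : measurable (g n @^-1` [set g n x]) by [].
  under eq_integral => w _ do rewrite muleCA -(EFinM (G w)).
  rewrite ge0_integralZl_EFin//=; last 2 first.
    - by move=> w _; rewrite lee_fin mulr_ge0.
    - by apply/measurable_EFinP; exact: measurable_funM.
  rewrite ge0_integralZl_EFin//=; last exact/measurable_EFinP.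
  rewrite GX// muleCA; congr (_ * (_ * _)).
  rewrite -[RHS](_ : \int[P]_w (\1_(X @^-1` (g n @^-1` [set g n x])) w)%:E = _)//.
  by rewrite integral_indic ?setIT// -[X in measurable X]setTI; exact: mX.
have lhs : \int[P]_w (G w * g n (X w))%:E @[n --> \oo] -->
    \int[P]_w (G w * f (X w))%:E.
  have := @cvg_monotone_convergence _ _ _ P _ measurableT
    (fun n w => (G w * g n (X w))%:E).
  rewrite (_ : \int[P]_w limn (fun n => (G w * g n (X w))%:E) =
               \int[P]_w (G w * f (X w))%:E); last first.
    apply: eq_integral => w _; apply/cvg_lim => //.
    under eq_fun do rewrite EFinM.
    by rewrite EFinM; apply: cvgeZl.
  apply.
  - by move=> n; apply/measurable_EFinP; exact: measurable_funM.
  - by move=> n w _; rewrite lee_fin mulr_ge0.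
  - by move=> w _ n m nm; rewrite lee_fin ler_wpM2l// nd_g.
have rhs : \int[P]_w (g n (X w))%:E @[n --> \oo] --> \int[P]_w (f (X w))%:E.
  have := @cvg_monotone_convergence _ _ _ P _ measurableT
    (fun n w => (g n (X w))%:E).
  rewrite (_ : \int[P]_w limn (fun n => (g n (X w))%:E) =
               \int[P]_w (f (X w))%:E); last first.
    by apply: eq_integral => w _; exact/cvg_lim.
  apply.
  - by move=> n; apply/measurable_EFinP.
  - by move=> n w _; rewrite lee_fin.
  - by move=> w _ n m nm; rewrite lee_fin nd_g.
rewrite (funext gE) in lhs.
exact: (cvg_unique (@ereal_hausdorff R) lhs (cvgeZl finG rhs)).
Qed.

Lemma expectation_prod_independent (I : finType) (X : I -> {RV P >-> R})
    (f : I -> R -> R) :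
  independent_RVs X -> (forall i, measurable_fun setT (f i)) ->
  (forall i x, (0 <= f i x <= 1)%R) ->
  \int[P]_w (\prod_i f i (X i w))%:E = \prod_i \int[P]_w (f i (X i w))%:E.
Proof.
move=> indX mf f01.
(* The indicators of the product rule are replaced by the [f i], one index at a
   time; [s] lists the indices already treated. *)
pose h (s : seq I) (B : I -> set R) i x : R := if i \in s then f i x else \1_(B i) x.
have mh s B i : (forall i, measurable (B i)) -> measurable_fun setT (h s B i).
  by move=> mB; rewrite /h; case: (i \in s) => //; exact: measurable_indic.
have h01 s B i x : (0 <= h s B i x <= 1)%R.
  by rewrite /h; case: ifP => // _; rewrite indicE ler0n lern1 leq_b1.
have mhX s B i : (forall i, measurable (B i)) ->
    measurable_fun setT (fun w => h s B i (X i w)).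
  by move=> mB; apply: (measurableT_comp (mh _ _ _ mB)).
suff main (s : seq I) B : (forall i, measurable (B i)) ->
    \int[P]_w (\prod_i h s B i (X i w))%:E = \prod_i \int[P]_w (h s B i (X i w))%:E.
  have := main (enum I) (fun=> setT) (fun=> measurableT).
  by under eq_integral do under eq_bigr do rewrite /h mem_enum;
     under [X in _ = X]eq_bigr do under eq_integral do rewrite /h mem_enum.
elim: s B => [|j s IH] B mB.
  rewrite /h /=.
  have mS := measurable_all_preimage X mB.
  transitivity (\int[P]_w (\1_[set w | forall i, B i (X i w)] w)%:E).
    apply: eq_integral => w _; congr EFin; rewrite [RHS]indicE.
    have [Bw|/existsNP[i Bw]] := pselect (forall i, B i (X i w)).
      rewrite mem_set// big1// => i _; rewrite indicE mem_set//; exact: Bw.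
    rewrite (@memNset _ [set w | _])/=; last by move=> /(_ i).
    by rewrite (bigD1 i)//= indicE memNset// mul0r.
  rewrite integral_indic// setIT; have /= -> := indX B mB; apply: eq_bigr => i _.
  rewrite -[RHS](_ : \int[P]_w (\1_(X i @^-1` B i) w)%:E = _)//.
  by rewrite integral_indic ?setIT//; exact: measurable_funPTI.
have [js|js] := boolP (j \in s).
  have hE : h (j :: s) B = h s B.
    apply/funext => i; apply/funext => x; rewrite /h in_cons.
    by have [->|] := eqVneq i j; rewrite ?js.
  by rewrite hE; exact: IH.
(* [G] collects the factors other than [j]. As [j] is not yet treated, its factor is still an
   indicator, and the induction hypothesis holds with [B j] replaced by any Borel set [C]: this is
   what [integral_mul_comp] requires in order to pass from [\1_C] to [f j]. *)
pose G w : R := (\prod_(i | i != j) h s B i (X i w))%R.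
have GE C : measurable C -> \int[P]_w (G w * \1_C (X j w))%:E =
    (\prod_(i | i != j) \int[P]_w (h s B i (X i w))%:E) * P (X j @^-1` C).
  move=> mC; pose B' i := if i == j then C else B i.
  have mB' i : measurable (B' i) by rewrite /B'; case: ifP.
  have hj : h s B' j = \1_C.
    by apply/funext => x; rewrite /h (negbTE js) /B' eqxx.
  have hi i : i != j -> h s B' i = h s B i.
    by move=> ij; apply/funext => x; rewrite /h /B' (negbTE ij).
  have := IH _ mB'.
  rewrite [X in _ = X](bigD1 j)//= hj muleC.
  under eq_integral do rewrite (bigD1 j)//= hj mulrC.
  have -> : \int[P]_w (\1_C (X j w))%:E = P (X j @^-1` C).
    rewrite -[LHS](_ : \int[P]_w (\1_(X j @^-1` C) w)%:E = _)//.
    by rewrite integral_indic ?setIT//; exact: measurable_funPTI.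
  move=> H; under [X in _ = X * _]eq_bigr => i ij do rewrite -(hi _ ij).
  by rewrite -H; apply: eq_integral => w _; congr (_ * _)%:E; apply: eq_bigr => i ij; rewrite hi.
have intG : \int[P]_w (G w)%:E = \prod_(i | i != j) \int[P]_w (h s B i (X i w))%:E.
  have := GE setT measurableT; rewrite preimage_setT probability_setT mule1 => <-.
  by apply: eq_integral => w _; rewrite indicT mulr1.
have G01 w : (0 <= G w <= 1)%R.
  rewrite /G; elim/big_rec : _ => [|i y _ /andP[y0 y1]]; first by rewrite ler01 lexx.
  by have /andP[? ?] := h01 s B i (X i w); rewrite mulr_ge0//= mulr_ile1.
have mG : measurable_fun setT G.
  rewrite /G; under eq_fun do rewrite -big_filter.
  by apply: measurable_prod => i _; exact: mhX.
have hji i : i != j -> h (j :: s) B i = h s B i.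
  by move=> ij; apply/funext => x; rewrite /h in_cons (negbTE ij).
have hj : h (j :: s) B j = f j by apply/funext => x; rewrite /h mem_head.
rewrite (bigD1 j)//= hj muleC.
under [X in _ = X * _]eq_bigr => i ij do rewrite hji//.
rewrite -intG -integral_mul_comp//.
- apply: eq_integral => w _; rewrite (bigD1 j)//= hj mulrC; congr (_ * _)%:E.
  by apply: eq_bigr => i ij; rewrite hji.
- by move=> w; have /andP[] := G01 w.
- by apply: integrable_fin_num => //; exact: integrable_unit_interval.
- by move=> C mC; rewrite GE// intG.
- by move=> x; have /andP[] := f01 j x.
Qed.

End expectation_product.

(** * The weight [exp (- x)] and its elementary inequalities *)

Section laplace_weight.
Local Open Scope classical_set_scope.
Context (R : realType).
Implicit Type x a : R.

(* Only used on almost surely nonnegative variables; the truncation keeps the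
   values in [0, 1] everywhere. *)
Definition damping x : R := expR (- Num.max x 0).

Lemma damping_gt0 x : 0 < damping x. Proof. exact: expR_gt0. Qed.

Lemma damping01 x : 0 <= damping x <= 1.
Proof. by rewrite expR_ge0 expR_le1 oppr_le0 le_max lexx orbT. Qed.

Lemma dampingX01 k x : 0 <= damping x ^+ k <= 1.
Proof. by have /andP[x0 x1] := damping01 x; rewrite exprn_ge0//= exprn_ile1. Qed.

Lemma measurable_dampingX k : measurable_fun setT (fun x => damping x ^+ k).
Proof.
apply: measurable_funX; apply: measurableT_comp => //; apply: measurableT_comp => //.
exact: measurable_maxr.
Qed.

Lemma damping_sum (I : finType) (x : I -> R) : (forall i, 0 <= x i) ->
  damping (\sum_i x i) = \prod_i damping (x i).
Proof.
move=> x0; rewrite /damping max_l ?sumr_ge0// -sumrN expR_sum.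
by apply: eq_bigr => i _; rewrite max_l.
Qed.

(* If [z >= expR (- a)] then [1 - z ^ 2 = (1 + z) (1 - z)] is at least
   [1 + expR (- a)] times [1 - z]. *)
Lemma damping_sqr_le a x : 0 <= a ->
  (1 + expR (- a)) * (1 - damping x) - \1_`]a, +oo[ x <= 1 - damping x ^+ 2.
Proof.
move=> a0; rewrite indicE mem_setE/= in_itv/= andbT.
have /andP[z0 z1] := damping01 x.
have a1 : expR (- a) <= 1 by rewrite expR_le1 oppr_le0.
have ea0 : 0 <= expR (- a) by exact: expR_ge0.
(* Beyond [a] the left side is at most [2 (1 - z) - 1 = 1 - 2 z], where [z = damping x], and
   [z ^ 2 <= 2 z]. *)
have [ax|xa] := ltP a x; first by rewrite /=; nra.
have : expR (- a) <= damping x.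
  by rewrite ler_expR lerN2 ge_max xa.
by rewrite /=; nra.
Qed.

End laplace_weight.

(** * Strict Jensen inequality for the square *)

Section strict_jensen.
Local Open Scope classical_set_scope.
Context d (T : measurableType d) (R : realType) (P : probability T R).

(** The variance is bounded below: [f] is at most half its mean [A] on a set [S] of positive
    probability, where [(f - A) ^ 2 >= (A / 2) ^ 2]. Integrating [(A / 2) ^ 2 \1_S <= (f - A) ^ 2]
    gives the strict inequality. *)
Lemma sqr_Rintegral_lt (f : T -> R) :
  measurable_fun setT f -> (forall w, 0 < f w <= 1) ->
  (forall e, 0 < e -> (0 < P [set w | (f w <= e)%R])%E) ->
  0 < \int[P]_w f w /\ (\int[P]_w f w) ^+ 2 < \int[P]_w (f w ^+ 2).
Proof.
move=> mf f01 Pe; set A := \int[P]_w f w.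
have f01' w : 0 <= f w <= 1 by have /andP[/ltW -> ->] := f01 w.
have fk01 k w : 0 <= f w ^+ k <= 1.
  by have /andP[x0 x1] := f01' w; rewrite exprn_ge0//= exprn_ile1.
have intX k : P.-integrable setT (EFin \o (fun w => f w ^+ k)).
  by apply: integrable_unit_interval => //; exact: measurable_funX.
have intf : P.-integrable setT (EFin \o f) by exact: integrable_unit_interval.
have A0 : 0 < A.
  rewrite lt_neqAle Rintegral_ge0 ?andbT; last by move=> w _; have /andP[] := f01' w.
  apply/negP => /eqP A0.
  have : (\int[P]_w `|(f w)%:E| = 0)%E.
    rewrite (eq_integral (EFin \o f)); last first.
      by move=> w _; rewrite gee0_abs// lee_fin; have /andP[] := f01' w.
    by rewrite -[LHS]fineK ?integrable_fin_num// -/(Rintegral _ _ _) -/A -A0.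
  move/(ae_eq_integral_abs _ measurableT (measurable_int _ intf)).
  (* [f] is positive everywhere, so a null set outside which it vanishes must be the whole space. *)
  move=> [N [mN PN fN]]; have : (P setT <= P N)%E.
    apply: le_measure; rewrite ?inE// => w _; apply: fN => /= /(_ Logic.I) [fw0].
    by have := f01 w; rewrite fw0 ltxx.
  by rewrite PN probability_setT lee_fin ler10.
split => //.
set S := [set w | f w <= A / 2].
have mS : measurable S by rewrite -[S]setTI; exact: measurable_fun_le.
have PS : 0 < fine (P S) by rewrite fine_gt0// Pe ?divr_gt0//= ltey_eq fin_num_measure.
have int1 : P.-integrable setT (EFin \o (\1_S : T -> R)).
  apply: integrable_unit_interval; first exact: measurable_indic.
  by move=> w; rewrite indicE ler0n lern1 leq_b1.
have intc (c : R) : P.-integrable setT (EFin \o (fun=> c)).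
  exact: finite_measure_integrable_cst.
have intZ (c : R) : P.-integrable setT (EFin \o (fun w => c * f w)).
  exact: (integrableZl measurableT c intf).
have intB (b c : R) : P.-integrable setT (EFin \o (fun w => b - c * f w)).
  exact: (integrableB measurableT (intc b) (intZ c)).
have : \int[P]_w ((A / 2) ^+ 2 * \1_S w) <=
       \int[P]_w (f w ^+ 2 + (A ^+ 2 - (2 * A) * f w)).
  apply: le_Rintegral => //=.
  - exact: (integrableZl measurableT _ int1).
  - exact: (integrableD measurableT (intX 2%N) (intB _ _)).
  move=> w _; rewrite indicE.
  have [wS|_] := boolP (w \in S).
    move: wS; rewrite inE /S/= mulr1 => fA.
    (* The product equals [(f w - A) ^ 2 - (A / 2) ^ 2]. *)
    have : 0 <= (A / 2 - f w) * (3 / 2 * A - f w) by rewrite mulr_ge0//; lra.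
    by nra.
  by rewrite mulr0; have := sqr_ge0 (f w - A); nra.
rewrite RintegralD// RintegralB// !RintegralZl// Rintegral_cst//.
rewrite -/A [fine (P setT)](_ : _ = 1) ?probability_setT//.
rewrite [\int[P]_w \1_S w](_ : _ = fine (P S)); last first.
  by rewrite /Rintegral integral_indic// setIT.
by move=> H; have : 0 < (A / 2) ^+ 2 * fine (P S); [rewrite mulr_gt0// exprn_gt0// divr_gt0|nra].
Qed.
End strict_jensen.

(** * Tail and Laplace transform of a sum of i.i.d. variables *)

Section iid_sum.
Local Open Scope classical_set_scope.
Context d (T : measurableType d) (R : realType) (P : probability T R) (m : nat).
Variables (X : 'I_m.+1 -> {RV P >-> R}) (mu : probability R R).
Hypothesis indX : independent_RVs X.
Hypothesis idX : forall i j, same_distribution (X i) (X j).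
Hypothesis sumX : forall A : set R, measurable A ->
  mu A = distribution P (\sum_(i < m.+1) X i) A.

(** The number of summands is written [m.+1] so that [X ord0] can represent the common law. *)
Lemma iid_all (B : set R) : measurable B ->
  P [set w | forall i, B (X i w)] = (fine (P (X ord0 @^-1` B)) ^+ m.+1)%:E.
Proof.
move=> mB; have /= -> := @indX (fun=> B) (fun=> mB).
rewrite (eq_bigr (fun=> (fine (P (X ord0 @^-1` B)))%:E)).
  by rewrite prodEFin prodr_const card_ord.
move=> i _; rewrite fineK; first exact: idX.
by rewrite fin_num_measure//; exact: measurable_funPTI.
Qed.

Lemma iid_sum_gt (a : R) :
  ((fine (P (X ord0 @^-1` `]a, +oo[)) ^+ m.+1)%:E <= mu `](m.+1%:R * a)%R, +oo[)%E.
Proof.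
rewrite -iid_all// sumX//; apply: le_measure; rewrite ?inE.
- exact: (@measurable_all_preimage _ _ _ P _ X (fun=> `]a, +oo[)).
- exact: measurable_funPTI.
move=> w /= Xa; rewrite in_itv/= andbT mfun_sum.
rewrite mulr_natl -[X in _ *+ X]card_ord -sumr_const.
apply: ltr_sum; first by apply/hasP; exists ord0; rewrite ?mem_index_enum.
by move=> i _; have := Xa i; rewrite in_itv/= andbT.
Qed.

(** If a summand were negative with probability [p > 0], then by independence all of them, hence the
    sum, would be negative with probability at least [p ^ m.+1 > 0]. *)
Lemma iid_sum_ge0 : mu `]-oo, 0[ = 0%E -> {ae P, forall w, forall i, 0 <= X i w}.
Proof.
move=> mu0.
have X00 : P (X ord0 @^-1` `]-oo, 0[) = 0%E.
  have : (P [set w | forall i, `]-oo, 0%R[%classic (X i w)] <= mu `]-oo, 0%R[)%E.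
    rewrite sumX//; apply: le_measure; rewrite ?inE.
    - exact: (@measurable_all_preimage _ _ _ P _ X (fun=> `]-oo, 0%R[)).
    - exact: measurable_funPTI.
    move=> w /= X0; rewrite in_itv/= mfun_sum.
    rewrite -[ltRHS](_ : \sum_(i < m.+1) 0 = 0); last by rewrite big1_eq.
    apply: ltr_sum; first by apply/hasP; exists ord0; rewrite ?mem_index_enum.
    by move=> i _; have := X0 i; rewrite in_itv/=.
  rewrite iid_all// mu0 lee_fin => p0.
  have : fine (P (X ord0 @^-1` `]-oo, 0[)) ^+ m.+1 == 0.
    by rewrite eq_le p0 exprn_ge0// fine_ge0.
  rewrite expf_eq0/= => /eqP p00.
  by rewrite -[LHS]fineK ?fin_num_measure//; [rewrite p00|exact: measurable_funPTI].
apply: filter_forall => i.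
exists (X i @^-1` `]-oo, 0[); split; first exact: measurable_funPTI.
  by rewrite -X00; exact: idX.
by move=> w /= /negP; rewrite -ltNge in_itv.
Qed.

(** The summands are almost surely nonnegative, so the truncation in [damping] is invisible and
    [damping] turns the sum into a product. The cases [k = 1] and [k = 2] are the Laplace transforms
    at 1 and 2. *)
Lemma iid_sum_damping k : mu `]-oo, 0[ = 0%E ->
  \int[mu]_x damping x ^+ k = (\int[P]_w damping (X ord0 w) ^+ k) ^+ m.+1.
Proof.
move=> mu0; rewrite /Rintegral.
have mXk (Y : {RV P >-> R}) : measurable_fun setT (fun w => damping (Y w) ^+ k).
  by apply: (measurableT_comp (measurable_dampingX k)).
have md : measurable_fun setT (fun x : R => (damping x ^+ k)%:E).
  by apply/measurable_EFinP; exact: measurable_dampingX.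
have d0 (x : R) : (0 <= (damping x ^+ k)%:E)%E.
  by rewrite lee_fin; have /andP[] := dampingX01 k x.
transitivity (fine (\int[P]_w (damping ((\sum_(i < m.+1) X i) w) ^+ k)%:E)).
  congr fine; rewrite (eq_measure_integral (distribution P (\sum_(i < m.+1) X i))).
    exact: ge0_integral_distribution.
  by move=> A mA _; exact: sumX.
transitivity (fine (\int[P]_w (\prod_i damping (X i w) ^+ k)%:E)).
  congr fine; apply: ge0_ae_eq_integral => //.
  - by apply/measurable_EFinP.
  - apply/measurable_EFinP; apply: measurable_prod => i _; exact: mXk.
  - move=> w _; rewrite lee_fin; apply: prodr_ge0 => i _.
    by have /andP[] := dampingX01 k (X i w).
  apply: filterS (iid_sum_ge0 mu0) => w X0 _.
  by rewrite mfun_sum damping_sum// prodrXl.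
rewrite (expectation_prod_independent indX (fun=> measurable_dampingX k)); last first.
  by move=> _ x; exact: dampingX01.
rewrite (eq_bigr (fun=> (fine (\int[P]_w (damping (X ord0 w) ^+ k)%:E))%:E)).
  by rewrite prodEFin prodr_const card_ord.
move=> i _; rewrite fineK; last first.
  apply: integrable_fin_num => //; apply: integrable_unit_interval => //.
  by move=> w; exact: dampingX01.
rewrite -(@ge0_integral_distribution _ _ _ _ _ P (X i) (fun x => (damping x ^+ k)%:E))//.
rewrite -(@ge0_integral_distribution _ _ _ _ _ P (X ord0) (fun x => (damping x ^+ k)%:E))//.
by apply: eq_measure_integral => A mA _; exact: idX.
Qed.

(** Let [q] and [r] be the means of [damping] and its square for one summand, and [p] its tail
    beyond [a]. Integrating [damping_sqr_le] gives [p >= (1 + exp (- a)) (1 - q) - (1 - r)]. Since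
    [q] and [r] are the [m.+1]-th roots of [A] and [B], estimating [1 - q] and [1 - r] by logarithms
    and multiplying by [m.+1] leaves only [A] and [B]. *)
Lemma iid_tail_ge (a : R) : mu `]-oo, 0[ = 0%E -> 0 <= a ->
  let A := \int[mu]_x damping x in let B := \int[mu]_x damping x ^+ 2 in
  0 < A -> 0 < B ->
  (1 + expR (- a)) * (1 + ln A / m.+1%:R) * (- ln A) + ln B <=
    m.+1%:R * fine (P (X ord0 @^-1` `]a, +oo[)).
Proof.
move=> mu0 a0 A B A0 B0.
set p := fine _; set n : R := m.+1%:R.
have n0 : 0 < n by rewrite ltr0n.
set q := \int[P]_w damping (X ord0 w).
set r := \int[P]_w damping (X ord0 w) ^+ 2.
have qA : A = q ^+ m.+1 by exact: (iid_sum_damping 1).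
have rB : B = r ^+ m.+1 by exact: iid_sum_damping.
have mXk k : measurable_fun setT (fun w => damping (X ord0 w) ^+ k).
  by apply: (measurableT_comp (measurable_dampingX k)).
have intX k : P.-integrable setT (EFin \o (fun w => damping (X ord0 w) ^+ k)).
  by apply: integrable_unit_interval => // w; exact: dampingX01.
have q0 : 0 < q.
  rewrite lt_neqAle Rintegral_ge0 ?andbT; last by move=> w _; exact/ltW/damping_gt0.
  by apply/eqP => q0; move: A0; rewrite qA -q0 expr0n ltxx.
have r0 : 0 < r.
  rewrite lt_neqAle Rintegral_ge0 ?andbT; last by move=> w _; rewrite sqr_ge0.
  by apply/eqP => r0; move: B0; rewrite rB -r0 expr0n ltxx.
have main : (1 + expR (- a)) * (1 - q) - p <= 1 - r.
  have intZ : P.-integrable setT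
      (EFin \o (fun w => (1 + expR (- a)) * (1 - damping (X ord0 w)))).
    exact: (integrableZl measurableT _ (integrableB measurableT (intX 0%N) (intX 1%N))).
  have int1 : P.-integrable setT (EFin \o (fun w => \1_`]a, +oo[ (X ord0 w) : R)).
    apply: integrable_unit_interval.
      by apply: (measurableT_comp (measurable_indic _)).
    by move=> w; rewrite indicE ler0n lern1 leq_b1.
  have /= := le_Rintegral measurableT (integrableB measurableT intZ int1)
    (integrableB measurableT (intX 0%N) (intX 2%N))
    (fun w _ => damping_sqr_le (X ord0 w) a0).
  rewrite RintegralB// RintegralB//.
  rewrite RintegralZl//; last first.
    exact: (integrableB measurableT (intX 0%N) (intX 1%N)).
  rewrite RintegralB//; [|exact: (intX 0%N)|exact: (intX 1%N)].
  rewrite Rintegral_cst// [fine (P setT)](_ : _ = 1) ?probability_setT// mul1r.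
  rewrite -/q -/r [X in _ - X <= _](_ : _ = p)//.
  rewrite /Rintegral -[X in fine X](_ : \int[P]_w (\1_(X ord0 @^-1` `]a, +oo[) w)%:E = _)%E//.
  by rewrite integral_indic ?setIT//; exact: measurable_funPTI.
have lnA : ln A = n * ln q by rewrite qA lnXn// mulr_natl.
have lnB : ln B = n * ln r by rewrite rB lnXn// mulr_natl.
have lnr : ln r <= r - 1.
  by rewrite -{1}(subrKC 1 r); apply: le_ln1Dx; rewrite ltrBrDl subrr.
have q1 : q <= 1.
  apply: Rintegral_le1 => [|w]; [exact: (mXk 1%N)|exact: damping01].
(* With [l = - ln q >= 0], the bound [exp l >= 1 + l] gives [l q <= 1 - q], and [q >= 1 - l]. *)
have lnq : - ln q * (1 + ln q) <= 1 - q.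
  have lnq0 : ln q <= 0 by exact: ln_le0.
  have q1l : 1 + ln q <= q by rewrite -[leRHS]lnK ?posrE// expR_ge1Dx.
  have : - ln q * q <= 1 - q.
    have := expR_ge1Dx (- ln q); rewrite expRN lnK ?posrE// -(ler_pM2l q0) mulfV ?gt_eqF//.
    by lra.
  by apply: le_trans; rewrite ler_wpM2l// oppr_ge0.
have -> : ln A / n = ln q by rewrite lnA mulrAC mulfV ?mul1r// gt_eqF.
rewrite lnA lnB.
have h1 : (1 + expR (- a)) * (- ln q * (1 + ln q)) <= 1 - r + p.
  by have : 0 <= expR (- a); [exact: expR_ge0|nra].
have h2 := ler_wpM2l (ltW n0) h1.
have h3 := ler_wpM2l (ltW n0) lnr.
by lra.
Qed.

End iid_sum.

(** As the number of summands grows, the lower bound of [iid_tail_ge] tends to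
    [(1 + exp (- a)) L + ln B] with [L = - ln A]. For small [a] this is close to
    [delta = ln (B / A ^ 2)], which is positive by strict Jensen. *)
Lemma infinitely_divisible_tail_ge (R : realType) (mu : probability R R) :
  infinitely_divisible mu -> mu `]-oo, 0[%classic = 0%E ->
  (forall K : R, 0 < mu `[K, +oo[%classic)%E ->
  exists a c : R, exists N : nat, [/\ 0 < a, 0 < c &
    forall m, (N <= m)%N ->
      (((c / m.+1%:R) ^+ m.+1)%:E <= mu `](m.+1%:R * a)%R, +oo[%classic)%E].
Proof.
move=> idmu mu0 muK.
have md k : measurable_fun setT (fun x : R => damping x ^+ k) := measurable_dampingX k.
have [|x|e e0|A0 AB] := @sqr_Rintegral_lt _ _ _ mu (@damping R); first exact: (md 1%N).
  by rewrite damping_gt0/=; have /andP[] := damping01 x.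
  (* [damping x <= e] as soon as [x >= - ln e], so the unbounded support makes [damping] arbitrarily
     small with positive probability. *)
  apply: (lt_le_trans (muK (- ln e))); apply: le_measure; rewrite ?inE//.
    by rewrite -[X in measurable X]setTI; apply: measurable_fun_le => //; exact: (md 1%N).
  move=> x /=; rewrite in_itv/= andbT => ex.
  rewrite -[leRHS]lnK ?posrE// ler_expR lerNl; apply: (le_trans ex).
  by rewrite le_max lexx.
set A := Rintegral _ _ _ in A0 AB; set B := Rintegral _ _ _ in AB.
have B0 : 0 < B by apply: le_lt_trans AB; exact: sqr_ge0.
have B1 : B <= 1 by apply: Rintegral_le1 => [|w]; [exact: md|exact: dampingX01].
pose L := - ln A; pose delta := 2 * L + ln B.
have delta0 : 0 < delta.
  have : ln (A ^+ 2) < ln B by rewrite ltr_ln ?posrE// exprn_gt0.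
  by rewrite lnXn// /delta /L; lra.
have L0 : 0 < L by have := ln_le0 B1; rewrite /delta in delta0; lra.
(* Chosen so that replacing [exp (- a)] by [1 - a] costs at most [a L = delta / 4]. *)
pose a := delta / (4 * L).
have a0 : 0 < a by rewrite divr_gt0// mulr_gt0.
have aL : a * L = delta / 4 by rewrite /a; field; rewrite gt_eqF.
(* Threshold for [n = m.+1]: the first term ensures [L / n <= 1], the second
   [2 L ^ 2 / n <= delta / 4]. *)
pose x := L + 8 * L ^+ 2 / delta.
have x0 : 0 <= x by rewrite addr_ge0 ?ltW// divr_gt0// mulr_gt0// exprn_gt0.
(* Two losses of [delta / 4] leave [c = delta / 2]. The successor forces [m >= 1], hence at least
   two summands, as [infinitely_divisible] demands. *)
exists a, (delta / 2), (Num.bound x).+1; split=> // [|m Nm]; first exact: divr_gt0.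
have [d [T [P [X [indX idX sumX]]]]] := idmu m.+1 (leq_trans (ltn0Sn _) Nm).
apply: le_trans (iid_sum_gt indX idX sumX a).
have n0 : 0 < m.+1%:R :> R by rewrite ltr0n.
rewrite lee_fin lerXn2r ?nnegrE ?divr_ge0 ?(ltW delta0) ?fine_ge0//.
rewrite ler_pdivrMr// [leRHS]mulrC.
apply: le_trans (iid_tail_ge indX idX sumX mu0 (ltW a0) A0 B0).
have xn : x <= m.+1%:R.
  apply: (le_trans (ltW (archi_boundP x0))); rewrite ler_nat.
  by apply: leq_trans (leqnSn m); exact: ltnW.
rewrite -/A -/B -/L.
have -> : ln A / m.+1%:R = - (L / m.+1%:R) by rewrite /L mulNr opprK.
set y := L / _.
have y1 : y <= 1.
  rewrite ler_pdivrMr// mul1r; apply: le_trans xn; rewrite lerDl ltW//.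
  by rewrite divr_gt0// mulr_gt0// exprn_gt0.
have yL : 2 * y * L <= delta / 4.
  have : 8 * L ^+ 2 / delta <= m.+1%:R by apply: le_trans xn; rewrite lerDr ltW.
  rewrite ler_pdivrMr// => H.
  rewrite -(ler_pM2r n0) (_ : 2 * y * L * m.+1%:R = 2 * L ^+ 2); first by lra.
  by rewrite /y; field; rewrite gt_eqF.
have ea : 1 - a <= expR (- a) by exact: expR_ge1Dx.
have y0 : 0 <= y by rewrite divr_ge0// ltW.
(* The left side is [2 L - a L - 2 y L + a L y]; adding [ln B] gives at least [delta / 2]. *)
have : (2 - a) * ((1 - y) * L) <= (1 + expR (- a)) * ((1 - y) * L).
  by rewrite ler_wpM2r ?mulr_ge0 ?subr_ge0// ?(ltW L0)//; lra.
have : 0 <= a * L * y by apply: mulr_ge0 => //; exact/ltW/mulr_gt0.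
rewrite mulrA.
rewrite /delta in aL yL *.
nra.
Qed.

(** * Tails of the stable subordinator and of its inverse *)

Section stable_inverse.
Local Open Scope classical_set_scope.
Context d (T : measurableType d) (R : realType) (P : probability T R).

Lemma le_measure_ae (A B : set T) : measurable A -> measurable B ->
  {ae P, forall w, A w -> B w} -> (P A <= P B)%E.
Proof.
move=> mA mB [N [mN PN ABN]].
rewrite -(measureU0 mB mN PN); apply: le_measure; rewrite ?inE//.
  exact: measurableU.
move=> w Aw; have [Bw|Bw] := pselect (B w); first by left.
by right; apply: ABN => /= /(_ Aw).
Qed.

Context (alpha : R) (S E : R -> {RV P >-> R}).
Hypothesis stableS : stable_subordinator alpha S.
Hypothesis inverseE : inverse_process S E.

(** Markov's inequality: the indicator of [S x <= t] is at most [exp (u t) exp (- u S x)], whose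
    mean is known. *)
Lemma stable_le_prob (u x t : R) : 0 < u -> 0 <= x ->
  (P (S x @^-1` `]-oo, t]) <= (expR (u * t - x * u `^ alpha))%:E)%E.
Proof.
move=> u0 x0; have [_ /(_ u x u0 x0)] := stableS; rewrite unlock => laplace.
have mL : measurable (S x @^-1` `]-oo, t]) by exact: measurable_funPTI.
rewrite expRD EFinM -mulNr -laplace -[X in P X]setIT -integral_indic//.
have mexp : measurable_fun setT (fun w => (expR (- u * S x w))%:E).
  by apply/measurable_EFinP; apply: measurableT_comp => //; exact: measurable_funM.
rewrite -ge0_integralZl_EFin ?expR_ge0//.
apply: ge0_le_integral => //.
- by apply/measurable_EFinP; exact: measurable_indic.
- exact: measurable_funeM.
move=> w _; rewrite -EFinM lee_fin indicE -expRD.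
have [|_] := boolP (w \in _); last by rewrite expR_ge0.
rewrite inE/= in_itv/= => St.
by rewrite -expR0 ler_expR mulNr subr_ge0 ler_pM2l.
Qed.

(** If [S x > t] almost surely, the Laplace transform is at most [exp (- u t)], so
    [u ^ (1 - alpha) <= x / t] for every [u > 0]; this fails for large [u]. *)
Lemma stable_le_prob_gt0 (x t : R) : alpha < 1 -> 0 <= x -> 0 < t ->
  (0 < P (S x @^-1` `]-oo, t]))%E.
Proof.
move=> alpha1 x0 t0.
have mL : measurable (S x @^-1` `]-oo, t]) by exact: measurable_funPTI.
rewrite lt_neqAle measure_ge0 andbT eq_sym; apply/eqP => P0.
have key u : 0 < u -> u * t <= x * u `^ alpha.
  move=> u0; have [_ /(_ u x u0 x0)] := stableS; rewrite unlock => laplace.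
  rewrite -lerN2 -ler_expR -mulNr -lee_fin -laplace.
  rewrite -[leRHS]mule1 -(probability_setT P) -integral_cst//.
  apply: ae_ge0_le_integral => //.
  - by apply/measurable_EFinP; apply: measurableT_comp => //; exact: measurable_funM.
  - by move=> w _; rewrite lee_fin expR_ge0.
  exists (S x @^-1` `]-oo, t]); split=> // w /= /not_implyP[_ /negP].
  rewrite lee_fin ler_expR mulNr lerN2 -ltNge ltr_pM2l// in_itv/=.
  exact: ltW.
(* [v] is a value exceeding [x / t], and [u] solves [u ^ (1 - alpha) = v]. *)
pose v := 1 + x / t.
have v0 : 0 < v by rewrite ltr_pwDl// divr_ge0// ltW.
pose u := v `^ (1 - alpha)^-1.
have u0 : 0 < u by exact: powR_gt0.
have uv : u `^ (1 - alpha) = v.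
  by rewrite -powRrM mulVf ?powRr1 ?ltW// subr_eq0 gt_eqF.
have := key u u0.
have -> : u `^ alpha = u / v.
  rewrite -uv -{2}(powRr1 (ltW u0)) -powRB ?(gt_eqF u0) ?implybT//.
  by rewrite subKr.
rewrite mulrCA ler_pM2l// ler_pdivlMr// /v mulrDr mulr1 mulrCA mulfV ?gt_eqF// mulr1.
lra.
Qed.

Lemma inverse_ge0 (t : R) : 0 <= t -> distribution P (E t) `]-oo, 0[ = 0%E.
Proof.
move=> t0; apply/eqP; rewrite eq_le measure_ge0 andbT.
rewrite -(measure0 P); apply: le_measure_ae => //; first exact: measurable_funPTI.
apply: filterS (inverseE t0) => w Ew; rewrite /= in_itv/= => E0.
have : (0%:E <= (E t w)%:E)%E.
  by rewrite Ew; apply/ereal_infP => _ [s [s0 _] <-]; rewrite lee_fin.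
by rewrite lee_fin leNgt E0.
Qed.

(** If [S x > t], then [x] lies in the set whose infimum is almost surely [E t], so [E t <= x]. *)
Lemma inverse_tail_le (u x t : R) : 0 < u -> 0 <= x -> 0 <= t ->
  (distribution P (E t) `]x, +oo[ <= (expR (u * t - x * u `^ alpha))%:E)%E.
Proof.
move=> u0 x0 t0; apply: le_trans (stable_le_prob t u0 x0).
apply: le_measure_ae; [exact: measurable_funPTI|exact: measurable_funPTI|].
apply: filterS (inverseE t0) => w Ew; rewrite /= !in_itv/= andbT => xE.
rewrite leNgt; apply/negP => tS.
have : ((E t w)%:E <= x%:E)%E by rewrite Ew; apply: ge_ereal_inf; exists x%:E => //; exists x.
by rewrite lee_fin leNgt xE.
Qed.

(** Supplies the unbounded support that makes Jensen strict. On a monotone path with [S y <= t],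
    every time at which [S] exceeds [t] is at least [y]; taking [y = max x 0] keeps the time
    nonnegative. *)
Lemma inverse_tail_gt0 (x t : R) : alpha < 1 -> 0 < t ->
  (0 < distribution P (E t) `[x, +oo[)%E.
Proof.
move=> alpha1 t0; have [[_ monoS] _] := stableS.
have y0 : 0 <= Num.max x 0 by rewrite le_max lexx orbT.
apply: (lt_le_trans (stable_le_prob_gt0 alpha1 y0 t0)).
apply: le_measure_ae; [exact: measurable_funPTI|exact: measurable_funPTI|].
apply: filterS2 (inverseE (ltW t0)) monoS => w Ew Smono.
rewrite /= !in_itv/= andbT => St.
rewrite -lee_fin Ew; apply/ereal_infP => _ [s [s0 tS] <-].
rewrite lee_fin; apply: (@le_trans _ _ (Num.max x 0)); first by rewrite le_max lexx.
rewrite leNgt; apply/negP => /ltW sy.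
by have := Smono s _ s0 sy; rewrite leNgt (le_lt_trans St tS).
Qed.

End stable_inverse.

(** After taking logarithms and dividing by [n = m.+1], the claim is
    [t - ln c + ln n < a n ^ alpha]. With [y = n ^ (alpha / 2)], the right side is [a y ^ 2] while
    [ln n < (2 / alpha) y], so for [y >= 1] it suffices that [a y >= C]. *)
Lemma expR_superlinear_lt (R : realType) (alpha a c t : R) (N : nat) :
  0 < alpha -> 0 < a -> 0 < c -> exists2 m, (N <= m)%N &
    expR (m.+1%:R * t - m.+1%:R * a * m.+1%:R `^ alpha) < (c / m.+1%:R) ^+ m.+1.
Proof.
move=> alpha0 a0 c0.
pose C := `|t - ln c| + 2 / alpha.
have C0 : 0 <= C by rewrite addr_ge0// divr_ge0// ltW.
pose Y := 1 + C / a.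
have Y0 : 0 < Y by rewrite ltr_pwDl// divr_ge0// ltW.
(* This makes [n >= Y ^ (2 / alpha)], that is [y >= Y], so that [y >= 1] and [a y >= a + C]. *)
pose m := maxn N (Num.bound (Y `^ (2 / alpha))).
exists m; first exact: leq_maxl.
set n : R := m.+1%:R; have n0 : 0 < n by rewrite ltr0n.
pose y := n `^ (alpha / 2).
have y0 : 0 < y by exact: powR_gt0.
have yY : Y <= y.
  rewrite (_ : Y = (Y `^ (2 / alpha)) `^ (alpha / 2)); last first.
    by rewrite -powRrM mulrA divfK ?gt_eqF// mulfV// powRr1// ltW.
  apply: ge0_ler_powR; rewrite ?nnegrE ?powR_ge0 ?divr_ge0 ?(ltW n0) ?(ltW alpha0)//.
  apply: (le_trans (ltW (archi_boundP (powR_ge0 _ _)))).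
  by rewrite ler_nat ltnW// ltnS leq_maxr.
have nE : n `^ alpha = y ^+ 2.
  by rewrite -powR_mulrn ?ltW// -powRrM divfK.
have lny : alpha / 2 * ln n < y.
  rewrite -ln_powR -/y; apply: (@lt_le_trans _ _ (1 + ln y)); first by rewrite ltrDr.
  by rewrite -[leRHS]lnK ?posrE// expR_ge1Dx.
have -> : (c / n) ^+ m.+1 = expR (n * (ln c - ln n)).
  rewrite -[in LHS](lnK (x := c / n)) ?posrE ?divr_gt0// -expRM_natl.
  by rewrite ln_div ?posrE.
rewrite ltr_expR -mulrA -mulrBr ltr_pM2l// nE.
have lnn : ln n < 2 / alpha * y.
  rewrite (_ : ln n = 2 / alpha * (alpha / 2 * ln n)); last by field; rewrite gt_eqF.
  by rewrite ltr_pM2l// divr_gt0.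
have aY : a * y >= a + C.
  rewrite -(_ : a * Y = a + C) ?ler_pM2l//.
  by rewrite /Y; field; rewrite gt_eqF.
have tC : t - ln c <= C - 2 / alpha by rewrite /C addrK ler_norm.
have y1 : 1 <= y by apply: le_trans yY; rewrite lerDl divr_ge0// ltW.
have tCy : t - ln c <= (C - 2 / alpha) * y.
  apply: (le_trans tC); rewrite ler_peMr//.
  by rewrite /C addrK.
have : (a + C) * y <= a * y * y by rewrite ler_pM2r.
nra.
Qed.

Unset Implicit Arguments.

Theorem proposition3p1 (d : measure_display) (T : measurableType d)
    (R : realType) (P : probability T R) (alpha : R)
    (S E : R -> {RV P >-> R}) :
  0 < alpha -> alpha < 1 ->
  stable_subordinator alpha S ->
  inverse_process S E ->
  forall t : R, 0 < t -> ~ infinitely_divisible (distribution P (E t)).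
Proof.
move=> alpha0 alpha1 stableS inverseE t t0 idE.
have [a [c [N [a0 c0 tail_ge]]]] := infinitely_divisible_tail_ge idE
  (inverse_ge0 inverseE (ltW t0))
  (fun K => inverse_tail_gt0 stableS inverseE K alpha1 t0).
have [m Nm] := expR_superlinear_lt t N alpha0 a0 c0.
have n0 : 0 < m.+1%:R :> R by rewrite ltr0n.
apply/negP; rewrite -leNgt -lee_fin; apply: (le_trans (tail_ge m Nm)).
by apply: (inverse_tail_le stableS inverseE n0 _ (ltW t0)); rewrite mulr_ge0// ltW.
Qed.
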